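(* Let $\mathbf{SC^k}$ be the free symmetric biassociative intermuting category generated by a set of objects (letters). Then $\mathbf{SC^k}$ is a diversified preorder: for every pair of arrows $f,g:A\to B$ of $\mathbf{SC^k}$ such that $A$ and $B$ are diversified formulae, we have $f=g$.
   Context: A biendofunctor of a category $\mathcal A$ is a functor $\mathcal A\times\mathcal A\to\mathcal A$. Let $\xi\in\{\wedge,\vee\}$; hats mark the natural transformations attached to $\wedge$ and checks those attached to $\vee$; $b$, $c$ without accent stand for the version belonging to $\xi$. A symmetric biassociative intermuting category $\langle\mathcal A,\wedge,\vee\rangle$ is a category $\mathcal A$ with biendofunctors $\wedge,\vee$ and: (1) natural isomorphisms $\hat b^{\to}_{A,B,C}:A\wedge(B\wedge C)\to(A\wedge B)\wedge C$, $\check b^{\to}_{A,B,C}:A\vee(B\vee C)\to(A\vee B)\vee C$, with inverses $\hat b^{\leftarrow}_{A,B,C},\check b^{\leftarrow}_{A,B,C}$, each satisfying $b^{\to}_{A\xi B,C,D}\circ b^{\to}_{A,B,C\xi D}=(b^{\to}_{A,B,C}\,\xi\,\mathbf 1_D)\circ b^{\to}_{A,B\xi C,D}\circ(\mathbf 1_A\,\xi\, b^{\to}_{B,C,D})$; (2) natural self-inverse isomorphisms $\hat c_{A,B}:A\wedge B\to B\wedge A$ and $\check c_{A,B}:A\vee B\to B\vee A$ (so $c_{B,A}\circ c_{A,B}=\mathbf 1$), each satisfying $c_{A,B\xi C}=b^{\to}_{B,C,A}\circ(\mathbf 1_B\,\xi\, c_{A,C})\circ b^{\leftarrow}_{B,A,C}\circ(c_{A,B}\,\xi\,\mathbf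 1_C)\circ b^{\to}_{A,B,C}$; (3) a natural transformation $c^k_{A,B,C,D}:(A\wedge B)\vee(C\wedge D)\to(A\vee C)\wedge(B\vee D)$ satisfying $$c^k_{A_1\vee A_2,A_1'\vee A_2',A_3,A_3'}\circ(c^k_{A_1,A_1',A_2,A_2'}\vee\mathbf 1_{A_3\wedge A_3'})\circ\check b^{\to}_{A_1\wedge A_1',A_2\wedge A_2',A_3\wedge A_3'}=(\check b^{\to}_{A_1,A_2,A_3}\wedge\check b^{\to}_{A_1',A_2',A_3'})\circ c^k_{A_1,A_1',A_2\vee A_3,A_2'\vee A_3'}\circ(\mathbf 1_{A_1\wedge A_1'}\vee c^k_{A_2,A_2',A_3,A_3'}),$$ $$\hat b^{\leftarrow}_{A_1\vee A_1',A_2\vee A_2',A_3\vee A_3'}\circ(c^k_{A_1,A_2,A_1',A_2'}\wedge\mathbf 1_{A_3\vee A_3'})\circ c^k_{A_1\wedge A_2,A_3,A_1'\wedge A_2',A_3'}=(\mathbf 1_{A_1\vee A_1'}\wedge c^k_{A_2,A_3,A_2',A_3'})\circ c^k_{A_1,A_2\wedge A_3,A_1',A_2'\wedge A_3'}\circ(\hat b^{\leftarrow}_{A_1,A_2,A_3}\vee\hat b^{\leftarrow}_{A_1',A_2',A_3'}),$$ $$c^k_{A_2,A_2',A_1,A_1'}\circ\check c_{A_1\wedge A_1',A_2\wedge A_2'}=(\check c_{A_1,A_2}\wedge\check c_{A_1',A_2'})\circ c^k_{A_1,A_1',A_2,A_2'},$$ $$\hat c_{A_1\vee A_1',A_2\vee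 A_2'}\circ c^k_{A_1,A_2,A_1',A_2'}=c^k_{A_2,A_1,A_2',A_1'}\circ(\hat c_{A_1,A_2}\vee\hat c_{A_1',A_2'}).$$ The free such category generated by a set of letters: objects are the formulae built from letters by the binary connectives $\wedge,\vee$. Arrow terms are typed expressions generated from $\mathbf 1_A$ and the components (with formulae as indices) of $\hat b^{\to},\hat b^{\leftarrow},\check b^{\to},\check b^{\leftarrow},\hat c,\check c,c^k$ by composition $\circ$ (when types match) and the operations $\wedge,\vee$. Arrows are equivalence classes of arrow terms under the smallest equivalence relation, congruent with respect to $\circ,\wedge,\vee$, containing the category equations, functoriality of $\wedge,\vee$, naturality and isomorphism equations, and the equations listed above. A formula is diversified when every letter occurs in it at most once. *)

(* Defs.v *)
From Stdlib Require Import List.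

Set Implicit Arguments.
Unset Strict Implicit.

(* The two connectives are a parameter of the formula, arrow-term and equation
   constructors that come in a /\-version and a \/-version. *)
Inductive connective : Type := Conj | Disj.

Inductive formula (L : Type) : Type :=
| letter (p : L)
| bin (x : connective) (A B : formula L).

Arguments letter {L} p.
Arguments bin {L} x A B.

Declare Scope formula_scope.
Delimit Scope formula_scope with form.
Bind Scope formula_scope with formula.
Notation "A /\ B" := (bin Conj A B) : formula_scope.
Notation "A \/ B" := (bin Disj A B) : formula_scope.

Fixpoint letters (L : Type) (A : formula L) : list L :=
  match A with
  | letter p => p :: nil
  | bin _ A1 A2 => letters A1 ++ letters A2
  end.

Definition diversified (L : Type) (A : formula L) : Prop := NoDup (letters A).

Section ArrowTerms.
Variable L : Type.
Implicit Types A B C D : formula L.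

(* [b_to x], [b_from x] and [csym x] are the hatted transformations for
   [x = Conj] and the checked ones for [x = Disj]. *)
Inductive term : formula L -> formula L -> Type :=
| one A : term A A
| comp A B C (g : term B C) (f : term A B) : term A C
| par (x : connective) A B A' B' (f : term A A') (g : term B B') :
    term (bin x A B) (bin x A' B')
| b_to (x : connective) A B C :
    term (bin x A (bin x B C)) (bin x (bin x A B) C)
| b_from (x : connective) A B C :
    term (bin x (bin x A B) C) (bin x A (bin x B C))
| csym (x : connective) A B : term (bin x A B) (bin x B A)
| ck A B C D : term ((A /\ B) \/ (C /\ D)) ((A \/ C) /\ (B \/ D)).

End ArrowTerms.

Arguments one {L} A.
Arguments b_to {L} x A B C.
Arguments b_from {L} x A B C.
Arguments csym {L} x A B.
Arguments ck {L} A B C D.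

Declare Scope term_scope.
Delimit Scope term_scope with term.
Bind Scope term_scope with term.
Notation "g ∘ f" := (comp g f) (at level 40, left associativity) : term_scope.
Notation "f /\ g" := (par Conj f g) : term_scope.
Notation "f \/ g" := (par Disj f g) : term_scope.

Reserved Notation "f === g" (at level 70, no associativity).

Section ArrowTermEquality.
Variable L : Type.
Implicit Types A B C D : formula L.
Local Open Scope term_scope.

(* Naturality of [b_from] is not listed: it follows from that of [b_to] and the
   isomorphism equations. *)
Inductive term_eq : forall A B : formula L, term A B -> term A B -> Prop :=
| te_refl A B (f : term A B) : f === f
| te_sym A B (f g : term A B) : f === g -> g === f
| te_trans A B (f g h : term A B) : f === g -> g === h -> f === h
| te_comp A B C (g g' : term B C) (f f' : term A B) :
    g === g' -> f === f' -> g ∘ f === g' ∘ f'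
| te_par x A B A' B' (f f' : term A A') (g g' : term B B') :
    f === f' -> g === g' -> par x f g === par x f' g'

| te_idl A B (f : term A B) : one B ∘ f === f
| te_idr A B (f : term A B) : f ∘ one A === f
| te_assoc A B C D (h : term C D) (g : term B C) (f : term A B) :
    h ∘ (g ∘ f) === (h ∘ g) ∘ f

| te_par_id x A B : par x (one A) (one B) === one (bin x A B)
| te_par_comp x A B C A' B' C'
    (g : term B C) (f : term A B) (g' : term B' C') (f' : term A' B') :
    par x (g ∘ f) (g' ∘ f') === par x g g' ∘ par x f f'

| te_b_nat x A B C A' B' C' (f : term A A') (g : term B B') (h : term C C') :
    par x (par x f g) h ∘ b_to x A B C
    === b_to x A' B' C' ∘ par x f (par x g h)
| te_c_nat x A B A' B' (f : term A A') (g : term B B') :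
    par x g f ∘ csym x A B === csym x A' B' ∘ par x f g
| te_ck_nat A B C D A' B' C' D'
    (f : term A A') (g : term B B') (h : term C C') (k : term D D') :
    ((f \/ h) /\ (g \/ k)) ∘ ck A B C D
    === ck A' B' C' D' ∘ ((f /\ g) \/ (h /\ k))

| te_b_to_from x A B C :
    b_to x A B C ∘ b_from x A B C === one (bin x (bin x A B) C)
| te_b_from_to x A B C :
    b_from x A B C ∘ b_to x A B C === one (bin x A (bin x B C))
| te_c_inv x A B : csym x B A ∘ csym x A B === one (bin x A B)

| te_pentagon x A B C D :
    b_to x (bin x A B) C D ∘ b_to x A B (bin x C D)
    === par x (b_to x A B C) (one D) ∘ b_to x A (bin x B C) D
        ∘ par x (one A) (b_to x B C D)
| te_hexagon x A B C :
    csym x A (bin x B C)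
    === b_to x B C A ∘ par x (one B) (csym x A C) ∘ b_from x B A C
        ∘ par x (csym x A B) (one C) ∘ b_to x A B C

| te_ck_b_disj A1 A1' A2 A2' A3 A3' :
    ck (A1 \/ A2) (A1' \/ A2') A3 A3'
      ∘ (ck A1 A1' A2 A2' \/ one (A3 /\ A3'))
      ∘ b_to Disj (A1 /\ A1') (A2 /\ A2') (A3 /\ A3')
    === (b_to Disj A1 A2 A3 /\ b_to Disj A1' A2' A3')
        ∘ ck A1 A1' (A2 \/ A3) (A2' \/ A3')
        ∘ (one (A1 /\ A1') \/ ck A2 A2' A3 A3')
| te_ck_b_conj A1 A1' A2 A2' A3 A3' :
    b_from Conj (A1 \/ A1') (A2 \/ A2') (A3 \/ A3')
      ∘ (ck A1 A2 A1' A2' /\ one (A3 \/ A3'))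
      ∘ ck (A1 /\ A2) A3 (A1' /\ A2') A3'
    === (one (A1 \/ A1') /\ ck A2 A3 A2' A3')
        ∘ ck A1 (A2 /\ A3) A1' (A2' /\ A3')
        ∘ (b_from Conj A1 A2 A3 \/ b_from Conj A1' A2' A3')
| te_ck_c_disj A1 A1' A2 A2' :
    ck A2 A2' A1 A1' ∘ csym Disj (A1 /\ A1') (A2 /\ A2')
    === (csym Disj A1 A2 /\ csym Disj A1' A2') ∘ ck A1 A1' A2 A2'
| te_ck_c_conj A1 A1' A2 A2' :
    csym Conj (A1 \/ A1') (A2 \/ A2') ∘ ck A1 A2 A1' A2'
    === ck A2 A1 A2' A1' ∘ (csym Conj A1 A2 \/ csym Conj A1' A2')

where "f === g" := (term_eq f g).

End ArrowTermEquality.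

(* The arrows A -> B of the free category on the letters L, as the quotient of
   the arrow terms: [term_eq f], a predicate on [term A B], is the equivalence
   class of [f]. *)
Definition SCk_arrow (L : Type) (A B : formula L) : Type :=
  { X : term A B -> Prop | exists f : term A B, X = term_eq f }.

(* Main.v *)
(** Fix a connective [y] and a set [S] of letters. Whenever possible, a formula [A] gets an
    arrow [A -> U y V] that separates its letters in [S] (collected in [U]) from the others
    (in [V]). It is built recursively: the arrows of the two halves of [A] are combined by a
    middle exchange, which is [ck] if [A] is a disjunction and [y] is the conjunction, and is
    made of associativities and symmetries if [A] has main connective [y].
    This separation is natural: for every [f : A -> B], a separation of [B] lifts to one of
    [A], and [f] becomes a [y]-product [f1 y f2]. Taking [B = B1 y B2] and [S] the letters
    of [B1], the separation of [B] is the identity, hence [f] equals [f1 y f2] after the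
    separation of [A], which depends only on [A] and [S]. Induction on [B] gives uniqueness.
    Naturality for one connective uses coherence of symmetric associative categories,
    which is obtained from the same argument with [S] a singleton: there few cases arise,
    and they are pentagons and hexagons. *)

From Stdlib Require Import List Permutation Setoid Morphisms Arith Lia Eqdep
  ClassicalEpsilon FunctionalExtensionality PropExtensionality ProofIrrelevance.
Require Import Defs.

Set Implicit Arguments.
Unset Strict Implicit.

Local Notation "f === g" := (term_eq f g).
Local Notation "g ∘ f" := (comp g f) (at level 40, left associativity).

(** * Rewriting modulo equality of arrow terms *)

#[local] Instance term_eq_equiv L (A B : formula L) : Equivalence (@term_eq L A B).
Proof.
  split; [intro; apply te_refl | intros f g; apply te_sym | intros f g h; apply te_trans].
Qed.

#[local] Instance comp_proper L (A B C : formula L) :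
  Proper (@term_eq L B C ==> @term_eq L A B ==> @term_eq L A C) (@comp L A B C).
Proof. intros g g' Hg f f' Hf; now apply te_comp. Qed.

#[local] Instance par_proper L x (A B A' B' : formula L) :
  Proper (@term_eq L A A' ==> @term_eq L B B' ==> @term_eq L (bin x A B) (bin x A' B'))
    (@par L x A B A' B').
Proof. intros f f' Hf g g' Hg; now apply te_par. Qed.

(** * Middle exchanges, and the pentagons and hexagons they satisfy *)

Section Structural.
Variable L : Type.
Implicit Types A B C D U V : formula L.

Lemma idl A B (f : term A B) : one B ∘ f === f. Proof. apply te_idl. Qed.
Lemma idr A B (f : term A B) : f ∘ one A === f. Proof. apply te_idr. Qed.
Lemma assoc A B C D (h : term C D) (g : term B C) (f : term A B) :
  (h ∘ g) ∘ f === h ∘ (g ∘ f).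
Proof. symmetry; apply te_assoc. Qed.
Lemma par_comp x A B C A' B' C'
    (g : term B C) (f : term A B) (g' : term B' C') (f' : term A' B') :
  par x g g' ∘ par x f f' === par x (g ∘ f) (g' ∘ f').
Proof. symmetry; apply te_par_comp. Qed.
Lemma par_comp_l x A B C A' B' C' D
    (g : term B C) (f : term A B) (g' : term B' C') (f' : term A' B')
    (h : term D (bin x A A')) :
  par x g g' ∘ (par x f f' ∘ h) === par x (g ∘ f) (g' ∘ f') ∘ h.
Proof. now rewrite te_assoc, par_comp. Qed.
Lemma par_one x A B : par x (one A) (one B) === one (bin x A B).
Proof. apply te_par_id. Qed.

Lemma b_from_nat x A B C A' B' C' (f : term A A') (g : term B B') (h : term C C') :
  par x f (par x g h) ∘ b_from x A B C === b_from x A' B' C' ∘ par x (par x f g) h.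
Proof.
  transitivity (b_from x A' B' C' ∘ (b_to x A' B' C' ∘ par x f (par x g h)) ∘ b_from x A B C).
  - now rewrite (te_assoc (b_from _ _ _ _)), te_b_from_to, idl.
  - now rewrite <- te_b_nat, !assoc, te_b_to_from, idr.
Qed.

Lemma cancel_mid A B C (g : term B A) (f : term A B) (k : term C A) :
  g ∘ f === one A -> g ∘ (f ∘ k) === k.
Proof. intro E; now rewrite te_assoc, E, idl. Qed.

Lemma b_to_from_mid x A B C D (k : term D _) : b_to x A B C ∘ (b_from x A B C ∘ k) === k.
Proof. apply cancel_mid, te_b_to_from. Qed.
Lemma b_from_to_mid x A B C D (k : term D _) : b_from x A B C ∘ (b_to x A B C ∘ k) === k.
Proof. apply cancel_mid, te_b_from_to. Qed.

(* Middle exchanges within one connective; the two letters are the shapes of the factors,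
   see [shape]: already in [U] (l), already in [V] (r), or separated (s). *)
Definition w_rs y A U V : term (bin y A (bin y U V)) (bin y U (bin y A V)) :=
  b_from y U A V ∘ par y (csym y A U) (one V) ∘ b_to y A U V.
Definition w_sl y U V B : term (bin y (bin y U V) B) (bin y (bin y U B) V) :=
  b_to y U B V ∘ par y (one U) (csym y V B) ∘ b_from y U V B.
Definition w_ss y A B C D :
    term (bin y (bin y A B) (bin y C D)) (bin y (bin y A C) (bin y B D)) :=
  b_to y A C (bin y B D) ∘ par y (one A) (w_rs y B C D) ∘ b_from y A B (bin y C D).

Lemma iso_l A B C (i : term B C) (j : term C B) (f g : term A B) :
  j ∘ i === one B -> i ∘ f === i ∘ g -> f === g.
Proof.
  intros E H. rewrite <- (idl f), <- (idl g), <- E, !assoc, H. reflexivity.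
Qed.
Lemma iso_r A B C (i : term A B) (j : term B A) (f g : term B C) :
  i ∘ j === one B -> f ∘ i === g ∘ i -> f === g.
Proof.
  intros E H. rewrite <- (idr f), <- (idr g), <- E, !te_assoc, H. reflexivity.
Qed.

(** The pentagon with some of its sides inverted. Here and below the suffix gives the shapes of the
    three factors for which the equation is the naturality of separation along [b_to]. *)
Lemma pent_srr y U V B C :
  par y (one U) (b_to y V B C) ∘ b_from y U V (bin y B C)
  === b_from y U (bin y V B) C ∘ par y (b_from y U V B) (one C) ∘ b_to y (bin y U V) B C.
Proof.
  apply (@iso_r _ _ _ (b_to y U V (bin y B C)) (b_from y U V (bin y B C)));
    [apply te_b_to_from|].
  rewrite !assoc, te_b_from_to, te_pentagon, idr.
  rewrite !assoc, par_comp_l, te_b_from_to, idl, par_one, idl.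
  now rewrite b_from_to_mid.
Qed.

(** The hexagon for moving [C] past a product, inverted so that the product moves past [C]. *)
Lemma hex_rrl y A B C :
  csym y (bin y A B) C ∘ b_to y A B C
  === w_rs y A C B ∘ par y (one A) (csym y B C).
Proof.
  pose proof (te_hexagon y C A B) as H.
  apply (@iso_l _ _ _ (csym y C (bin y A B)) (csym y (bin y A B) C)); [apply te_c_inv|].
  rewrite te_assoc, te_c_inv, idl, H. unfold w_rs.
  rewrite !assoc. 
  rewrite b_to_from_mid, par_comp_l, te_c_inv, idl, par_one, idl, b_from_to_mid.
  now rewrite par_comp, te_c_inv, idl, par_one, idr.
Qed.

Lemma par_comp_one y A B C D (g : term B C) (f : term A B) :
  par y (g ∘ f) (one D) === par y g (one D) ∘ par y f (one D).
Proof. now rewrite par_comp, idl. Qed.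
Lemma par_one_comp y A B C D (g : term B C) (f : term A B) :
  par y (one D) (g ∘ f) === par y (one D) g ∘ par y (one D) f.
Proof. now rewrite par_comp, idl. Qed.

(** Two pentagons, one on each side of the symmetry of [A] and [U], which itself passes by
    naturality of [b_to]. *)
Lemma pent_rsr y A U V C :
  par y (one U) (b_to y A V C) ∘ (w_rs y A U (bin y V C) ∘ par y (one A) (b_from y U V C))
  === b_from y U (bin y A V) C ∘ par y (w_rs y A U V) (one C) ∘ b_to y A (bin y U V) C.
Proof.
  unfold w_rs.
  rewrite !assoc, (te_assoc (par y (one U) _) (b_from _ _ _ _)), pent_srr, !assoc.
  apply te_comp; [reflexivity|].
  rewrite !par_comp_one, !assoc.
  apply te_comp; [reflexivity|].
  rewrite <- (par_one y V C), (te_assoc (b_to _ _ _ _)), <- te_b_nat, !assoc.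
  apply te_comp; [reflexivity|].
  rewrite (te_assoc (b_to _ _ _ _)), te_pentagon, !assoc.
  now rewrite par_comp, te_b_to_from, idl, par_one, idr.
Qed.

(** Moving a product past [U] is moving its factors one after the other: [hex_rrl] splits the
    symmetry in two, and [pent_rsr] regroups. *)
Lemma hex_rrs y A B U V :
  par y (one U) (b_to y A B V) ∘ (w_rs y A U (bin y B V) ∘ par y (one A) (w_rs y B U V))
  === w_rs y (bin y A B) U V ∘ b_to y A B (bin y U V).
Proof.
  unfold w_rs at 2 3. rewrite !assoc, te_pentagon, !assoc, par_comp_l, hex_rrl, idl.
  rewrite !par_one_comp, par_comp_one, !assoc.
  rewrite (te_assoc (par y (par y _ _) _)), te_b_nat, !assoc.
  rewrite (te_assoc (w_rs _ _ _ _)), (te_assoc (par y (one U) _)), pent_rsr.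
  now rewrite !assoc.
Qed.

End Structural.

(** * Separations of formulae and their lifting along arrows *)

Section Statuses.
Variable L : Type.
Implicit Types A B C D U V : formula L.

Lemma w_rs_nat y A U V A' U' V' (f : term A A') (g : term U U') (h : term V V') :
  w_rs y A' U' V' ∘ par y f (par y g h) === par y g (par y f h) ∘ w_rs y A U V.
Proof.
  unfold w_rs.
  rewrite !assoc, <- te_b_nat, par_comp_l, <- te_c_nat, idl.
  rewrite <- (idr h) at 1. rewrite te_par_comp, !assoc, te_assoc, <- b_from_nat, !assoc.
  reflexivity.
Qed.

Lemma w_sl_nat y U V B U' V' B' (f : term U U') (g : term V V') (h : term B B') :
  w_sl y U' V' B' ∘ par y (par y f g) h === par y (par y f h) g ∘ w_sl y U V B.
Proof.
  unfold w_sl.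
  rewrite !assoc, <- b_from_nat, par_comp_l, <- te_c_nat, idl.
  rewrite <- (idr f) at 1. rewrite te_par_comp, !assoc, te_assoc, <- te_b_nat, !assoc.
  reflexivity.
Qed.

Lemma w_ss_nat y A B C D A' B' C' D'
    (f : term A A') (g : term B B') (h : term C C') (k : term D D') :
  w_ss y A' B' C' D' ∘ par y (par y f g) (par y h k)
  === par y (par y f h) (par y g k) ∘ w_ss y A B C D.
Proof.
  unfold w_ss.
  rewrite !assoc, <- b_from_nat, par_comp_l, w_rs_nat, idl.
  rewrite <- (idr f) at 1. rewrite te_par_comp, !assoc, te_assoc, <- te_b_nat, !assoc.
  reflexivity.
Qed.

(* Target of a separation: all letters are in [S] ([shL]), none is ([shR]), or both kinds
   occur ([shS]). The first two cases stand for a missing unit in [U y V]. *)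
Inductive shape : Type :=
| shL (A : formula L)
| shR (A : formula L)
| shS (U V : formula L).

Definition total (y : connective) (s : shape) : formula L :=
  match s with shL A => A | shR A => A | shS U V => bin y U V end.

Definition merging (x y : connective) (s t : shape) : Type :=
  { r : shape & term (bin x (total y s) (total y t)) (total y r) }.

Definition mk (x y : connective) (s t r : shape)
    (w : term (bin x (total y s) (total y t)) (total y r)) : option (merging x y s t) :=
  Some (existT _ r w).

Definition merge_same (y : connective) (s t : shape) : option (merging y y s t) :=
  match s, t with
  | shL A, shL B => mk (s := shL A) (t := shL B) (r := shL (bin y A B)) (one _)
  | shR A, shR B => mk (s := shR A) (t := shR B) (r := shR (bin y A B)) (one _)
  | shL A, shR B => mk (s := shL A) (t := shR B) (r := shS A B) (one _)
  | shR A, shL B => mk (s := shR A) (t := shL B) (r := shS B A) (csym y A B)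
  | shL A, shS U V =>
      mk (s := shL A) (t := shS U V) (r := shS (bin y A U) V) (b_to y A U V)
  | shR A, shS U V =>
      mk (s := shR A) (t := shS U V) (r := shS U (bin y A V)) (w_rs y A U V)
  | shS U V, shL B =>
      mk (s := shS U V) (t := shL B) (r := shS (bin y U B) V) (w_sl y U V B)
  | shS U V, shR B =>
      mk (s := shS U V) (t := shR B) (r := shS U (bin y V B)) (b_from y U V B)
  | shS U V, shS U' V' =>
      mk (s := shS U V) (t := shS U' V') (r := shS (bin y U U') (bin y V V'))
         (w_ss y U V U' V')
  end.

(** Two separated disjuncts are exchanged by [ck]. When the kinds differ, a unit would be missing
    among the arguments of [ck], so the separation fails. *)
Definition merge_disj_conj (s t : shape) : option (merging Disj Conj s t) :=
  match s, t with
  | shL A, shL B => mk (s := shL A) (t := shL B) (r := shL (bin Disj A B)) (one _)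
  | shR A, shR B => mk (s := shR A) (t := shR B) (r := shR (bin Disj A B)) (one _)
  | shS U V, shS U' V' =>
      mk (s := shS U V) (t := shS U' V') (r := shS (bin Disj U U') (bin Disj V V'))
         (ck U V U' V')
  | _, _ => None
  end.

(** Separated conjuncts fail here, since [ck] goes in the opposite direction. *)
Definition merge_conj_disj (s t : shape) : option (merging Conj Disj s t) :=
  match s, t with
  | shL A, shL B => mk (s := shL A) (t := shL B) (r := shL (bin Conj A B)) (one _)
  | shR A, shR B => mk (s := shR A) (t := shR B) (r := shR (bin Conj A B)) (one _)
  | _, _ => None
  end.

Definition merge (x y : connective) : forall s t : shape, option (merging x y s t) :=
  match x, y with
  | Conj, Conj => merge_same Conj
  | Disj, Disj => merge_same Disj
  | Disj, Conj => merge_disj_conj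
  | Conj, Disj => merge_conj_disj
  end.

(** Morphisms of shapes. They preserve the kind, and this alone decides whether a merge succeeds;
    with one side missing there is nothing to split, so every arrow is allowed. *)
Definition splits (y : connective) (s t : shape) : term (total y s) (total y t) -> Prop :=
  match s, t with
  | shL _, shL _ | shR _, shR _ => fun _ => True
  | shS U V, shS U' V' =>
      fun f => exists (g : term U U') (h : term V V'), f === par y g h
  | _, _ => fun _ => False
  end.

Lemma splits_one y s : splits (s := s) (t := s) (one (total y s)).
Proof. destruct s; simpl; trivial. do 2 eexists; symmetry; apply te_par_id. Qed.

Lemma splits_comp y s t r (f : term (total y s) (total y t)) (g : term (total y t) (total y r)) :
  splits f -> splits g -> splits (s := s) (t := r) (g ∘ f).
Proof.
  destruct s, t, r; simpl; trivial; try tauto.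
  intros (a & b & E) (a' & b' & E'). exists (a' ∘ a), (b' ∘ b).
  now rewrite E, E', par_comp.
Qed.

Record status (y : connective) (A : formula L) : Type :=
  Status { shape_of : shape; arrow_of : term A (total y shape_of) }.

Arguments Status {y A} shape_of arrow_of.

Definition smerge x y A B (a : option (status y A)) (b : option (status y B)) :
    option (status y (bin x A B)) :=
  match a, b with
  | Some (Status s f), Some (Status t g) =>
      match merge x y s t with
      | Some (existT _ r w) => Some (Status r (w ∘ par x f g))
      | None => None
      end
  | _, _ => None
  end.

(* [None] means that the formula cannot be separated; nothing is required of [f] when this
   happens at its target. *)
Definition lifts y A B (f : term A B) (a : option (status y A)) (b : option (status y B)) : Prop :=
  match b, a with
  | None, _ => True
  | Some _, None => False
  | Some (Status t g'), Some (Status s g) =>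
      exists h : term (total y s) (total y t), splits h /\ g' ∘ f === h ∘ g
  end.

(** The invertible version of [lifts], with failure at both ends or at neither. It passes to
    inverses, so that [b_from] is settled together with [b_to]. *)
Definition lifts_iso y A B (f : term A B) (a : option (status y A)) (b : option (status y B)) : Prop :=
  match b, a with
  | None, None => True
  | Some (Status t g'), Some (Status s g) =>
      exists (h : term (total y s) (total y t)) (k : term (total y t) (total y s)),
        splits h /\ splits k /\ h ∘ k === one _ /\ k ∘ h === one _ /\ g' ∘ f === h ∘ g
  | _, _ => False
  end.

Lemma lifts_one y A (a : option (status y A)) : lifts (one A) a a.
Proof.
  destruct a as [[s g]|]; simpl; trivial. exists (one _); split; [apply splits_one|].
  now rewrite idl, idr.
Qed.

Lemma lifts_comp y A B C (f : term A B) (g : term B C) (a : option (status y A))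
    (b : option (status y B)) (c : option (status y C)) :
  lifts f a b -> lifts g b c -> lifts (g ∘ f) a c.
Proof.
  destruct a as [[s a]|], b as [[t b]|], c as [[r c]|]; simpl; trivial; try tauto.
  intros (h & Hh & E) (k & Hk & E'). exists (k ∘ h); split; [now apply (@splits_comp y s t r)|].
  now rewrite te_assoc, E', !assoc, E.
Qed.

Lemma lifts_of_iso y A B (f : term A B) (a : option (status y A)) (b : option (status y B)) :
  lifts_iso f a b -> lifts f a b.
Proof.
  destruct a as [[s a]|], b as [[t b]|]; simpl; trivial; try tauto.
  intros (h & k & Hh & _ & _ & _ & E). now exists h.
Qed.

Lemma lifts_inverse y A B (f : term A B) (g : term B A)
    (a : option (status y A)) (b : option (status y B)) :
  f ∘ g === one B -> lifts_iso f a b -> lifts g b a.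
Proof.
  destruct a as [[s a]|], b as [[t b]|]; simpl; trivial; try tauto.
  intros Hfg (h & k & _ & Hk & _ & Hkh & E). exists k; split; trivial.
  rewrite <- (idl a), <- Hkh, (assoc k), <- E, !assoc, Hfg, idr. reflexivity.
Qed.

(** Success of a merge depends only on kinds, which [splits] preserves; the equation is then
    naturality of the exchange in question. *)
Lemma merge_nat x y s t s' t'
    (f : term (total y s) (total y s')) (g : term (total y t) (total y t')) :
  splits f -> splits g ->
  match merge x y s' t', merge x y s t with
  | None, _ => True
  | Some _, None => False
  | Some (existT _ r' w'), Some (existT _ r w) =>
      exists h : term (total y r) (total y r'), splits h /\ w' ∘ par x f g === h ∘ w
  end.
Proof.
  destruct s as [A|A|U V], s' as [A'|A'|U' V']; simpl; try tauto; intros Hf;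
  destruct t as [B|B|W Z], t' as [B'|B'|W' Z']; simpl; try tauto; intros Hg;
  repeat match goal with
  | H : exists a b, ?f === _ |- _ => let E := fresh in destruct H as (? & ? & E)
  end;
  destruct x, y; simpl; trivial;
  (* The equation is solved first: unification with the naturality law finds the witness, which is
     then seen to split. *)
  (eexists; split; cycle 1;
   [ etransitivity;
     [ repeat match goal with H : _ === _ |- _ => rewrite H; clear H end;
       solve
       [ rewrite idl, <- idr; reflexivity | symmetry; apply te_c_nat | symmetry; apply te_b_nat
       | symmetry; apply b_from_nat | apply w_rs_nat | apply w_sl_nat | apply w_ss_nat
       | symmetry; apply te_ck_nat ]
     | reflexivity ]
   | simpl; eauto using te_refl ]).
Qed.

Lemma lifts_par x y A B A' B' (f : term A A') (g : term B B') (a : option (status y A))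
    (a' : option (status y A')) (b : option (status y B)) (b' : option (status y B')) :
  lifts f a a' -> lifts g b b' -> lifts (par x f g) (smerge x a b) (smerge x a' b').
Proof.
  destruct a as [[s a]|], a' as [[s' a']|], b as [[t b]|], b' as [[t' b']|]; simpl; trivial;
    try tauto.
  intros (h & Hh & E) (k & Hk & E').
    pose proof (merge_nat x Hh Hk) as M.
    destruct (merge x y s' t') as [[r' w']|], (merge x y s t) as [[r w]|]; simpl; trivial.
    destruct M as (l & Hl & M). exists l; split; trivial.
    now rewrite assoc, par_comp, E, E', te_par_comp, <- assoc, M, assoc.
Qed.

(** A shape viewed as its own separation. By naturality of [b_to], [csym] and [ck], lifting along
    them reduces to such separations, hence to finitely many combinations of shapes. *)
Definition unit_status y (s : shape) : option (status y (total y s)) :=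
  Some (Status s (one (total y s))).

Lemma lifts_iso_b x y A B C s t r
    (f : term A (total y s)) (g : term B (total y t)) (h : term C (total y r)) :
  lifts_iso (b_to x _ _ _)
    (smerge x (unit_status y s) (smerge x (unit_status y t) (unit_status y r)))
    (smerge x (smerge x (unit_status y s) (unit_status y t)) (unit_status y r)) ->
  lifts_iso (b_to x A B C)
    (smerge x (Some (Status s f)) (smerge x (Some (Status t g)) (Some (Status r h))))
    (smerge x (smerge x (Some (Status s f)) (Some (Status t g))) (Some (Status r h))).
Proof.
  simpl.
  destruct (merge x y s t) as [[st w1]|], (merge x y t r) as [[tr w2]|]; simpl; trivial;
    try (destruct (merge x y st r) as [[str w3]|]); try (destruct (merge x y s tr) as [[str' w4]|]);
    simpl; trivial.
  intros (k & l & Hk & Hl & E & E' & F). exists k, l; repeat split; trivial.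
  rewrite !par_one, !idr in F.
  rewrite <- (idl h) at 1. rewrite <- (idl f) at 2.
  rewrite !te_par_comp, !assoc, te_b_nat, !te_assoc.
  rewrite F, !assoc. reflexivity.
Qed.

Lemma lifts_iso_c x y A B s t (f : term A (total y s)) (g : term B (total y t)) :
  lifts_iso (csym x _ _)
    (smerge x (unit_status y s) (unit_status y t))
    (smerge x (unit_status y t) (unit_status y s)) ->
  lifts_iso (csym x A B)
    (smerge x (Some (Status s f)) (Some (Status t g)))
    (smerge x (Some (Status t g)) (Some (Status s f))).
Proof.
  simpl.
  destruct (merge x y s t) as [[st w1]|], (merge x y t s) as [[ts w2]|]; simpl; trivial.
  intros (k & l & Hk & Hl & E & E' & F). exists k, l; repeat split; trivial.
  rewrite !par_one, !idr in F.
  now rewrite assoc, te_c_nat, te_assoc, F, assoc.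
Qed.

Lemma lifts_ck y A B C D s t r u (f : term A (total y s)) (g : term B (total y t))
    (h : term C (total y r)) (k : term D (total y u)) :
  lifts (ck _ _ _ _)
    (smerge Disj (smerge Conj (unit_status y s) (unit_status y t))
                 (smerge Conj (unit_status y r) (unit_status y u)))
    (smerge Conj (smerge Disj (unit_status y s) (unit_status y r))
                 (smerge Disj (unit_status y t) (unit_status y u))) ->
  lifts (ck A B C D)
    (smerge Disj (smerge Conj (Some (Status s f)) (Some (Status t g)))
                 (smerge Conj (Some (Status r h)) (Some (Status u k))))
    (smerge Conj (smerge Disj (Some (Status s f)) (Some (Status r h)))
                 (smerge Disj (Some (Status t g)) (Some (Status u k)))).
Proof.
  cbn -[merge].
  destruct (merge Disj y s r) as [[sr w1]|], (merge Disj y t u) as [[tu w2]|]; cbn -[merge]; trivial.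
  destruct (merge Conj y sr tu) as [[srtu w3]|]; cbn -[merge]; trivial.
  destruct (merge Conj y s t) as [[st w4]|]; cbn -[merge]; trivial.
  destruct (merge Conj y r u) as [[ru w5]|]; cbn -[merge]; trivial.
  destruct (merge Disj y st ru) as [[stru w6]|]; cbn -[merge]; trivial.
  intros (p & Hp & E). exists p; split; trivial.
  rewrite !par_one, !idr in E.
  now rewrite !te_par_comp, !assoc, te_ck_nat, !te_assoc, E, !assoc.
Qed.

Fixpoint status_at (y : connective) (S : L -> bool) A : option (status y A) :=
  match A with
  | letter p =>
      Some (if S p then Status (shL (letter p)) (one _) else Status (shR (letter p)) (one _))
  | bin x B C => smerge x (status_at y S B) (status_at y S C)
  end.

(** Induction on the arrow term, relative to an invariant [P] inherited along arrows and by
    subformulae. It serves twice: with pure diversified formulae, and with no restriction. *)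
Lemma status_at_lifts y S (P : formula L -> Prop) :
  (forall A B, term A B -> P A -> P B) ->
  (forall x A B, P (bin x A B) -> P A /\ P B) ->
  (forall x A B C, P (bin x A (bin x B C)) ->
    lifts_iso (b_to x A B C) (status_at y S (bin x A (bin x B C)))
      (status_at y S (bin x (bin x A B) C))) ->
  (forall x A B, P (bin x A B) ->
    lifts_iso (csym x A B) (status_at y S (bin x A B)) (status_at y S (bin x B A))) ->
  (forall A B C D, P (bin Disj (bin Conj A B) (bin Conj C D)) ->
    lifts (ck A B C D) (status_at y S (bin Disj (bin Conj A B) (bin Conj C D)))
      (status_at y S (bin Conj (bin Disj A C) (bin Disj B D)))) ->
  forall A B (f : term A B), P A -> lifts f (status_at y S A) (status_at y S B).
Proof.
  intros Pt Ps Hb Hc Hk A B f.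
  induction f as [A|A B C g IHg f IHf|x A B A' B' f IHf g IHg|x A B C|x A B C|x A B|A B C D];
    intro HA.
  - apply lifts_one.
  - eapply lifts_comp; [apply IHf, HA|apply IHg, (Pt _ _ f HA)].
  - apply Ps in HA. simpl. apply lifts_par; tauto.
  - apply lifts_of_iso, Hb, HA.
  - apply (lifts_inverse (te_b_to_from x A B C)).
    apply Hb. exact (Pt _ _ (b_from x A B C) HA).
  - apply lifts_of_iso, Hc, HA.
  - apply Hk, HA.
Qed.

Definition kind_spec (y : connective) (S : L -> bool) A (a : option (status y A)) : Prop :=
  match a with
  | None => True
  | Some (Status (shL _) _) => forall q, In q (letters A) -> S q = true
  | Some (Status (shR _) _) => forall q, In q (letters A) -> S q = false
  | Some (Status (shS _ _) _) =>
      (exists q, In q (letters A) /\ S q = true) /\ (exists q, In q (letters A) /\ S q = false)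
  end.

Lemma letters_nonempty A : exists q, In q (letters A).
Proof.
  induction A as [p|x A [q Hq] B _]; simpl; eauto using in_or_app.
Qed.

Lemma status_at_kind y S A : kind_spec S (status_at y S A).
Proof.
  induction A as [p|x A IHA B IHB]; simpl.
  - destruct (S p) eqn:E; simpl; intros q [<-|[]]; trivial.
  - destruct (letters_nonempty A) as [a Ha], (letters_nonempty B) as [b Hb].
    destruct (status_at y S A) as [[s f]|], (status_at y S B) as [[t g]|]; simpl; trivial.
    destruct s, t, x, y; simpl in *; trivial;
      solve [intros q Hq; apply in_app_or in Hq; firstorder
            | firstorder eauto using in_or_app
            | split; [eexists; split; [apply in_or_app|]|eexists; split; [apply in_or_app|]];
              firstorder eauto].
Qed.

(** Merging two shapes [shL] succeeds for every pair of connectives, and with an identity; the same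
    holds for [shR] in the next lemma. *)
Lemma status_at_left y S A :
  (forall q, In q (letters A) -> S q = true) ->
  exists f, status_at y S A = Some (Status (shL A) f) /\ f === one A.
Proof.
  induction A as [p|x A IHA B IHB]; simpl; intro H.
  - rewrite H by auto. eexists; split; reflexivity.
  - destruct IHA as (f & -> & Ef); [auto using in_or_app|].
    destruct IHB as (g & -> & Eg); [auto using in_or_app|].
    destruct x, y; simpl; (eexists; split; [reflexivity|]);
      now rewrite Ef, Eg, te_par_id, te_idl.
Qed.

Lemma status_at_right y S A :
  (forall q, In q (letters A) -> S q = false) ->
  exists f, status_at y S A = Some (Status (shR A) f) /\ f === one A.
Proof.
  induction A as [p|x A IHA B IHB]; simpl; intro H.
  - rewrite H by auto. eexists; split; reflexivity.
  - destruct IHA as (f & -> & Ef); [auto using in_or_app|].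
    destruct IHB as (g & -> & Eg); [auto using in_or_app|].
    destruct x, y; simpl; (eexists; split; [reflexivity|]);
      now rewrite Ef, Eg, te_par_id, te_idl.
Qed.

Lemma term_letters A B : term A B -> Permutation (letters A) (letters B).
Proof.
  induction 1; simpl.
  - reflexivity.
  - etransitivity; eauto.
  - now apply Permutation_app.
  - now rewrite app_assoc.
  - now rewrite app_assoc.
  - apply Permutation_app_comm.
  - rewrite <- !app_assoc. apply Permutation_app_head.
    rewrite !app_assoc. apply Permutation_app_tail, Permutation_app_comm.
Qed.

End Statuses.

Arguments Status {L y A} shape_of arrow_of.

(** * Formulae with a single connective, and arrows out of a letter *)

Section Pure.
Variable L : Type.
Implicit Types A B C D U V : formula L.

Fixpoint pure (y : connective) A : Prop :=
  match A with
  | letter _ => True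
  | bin x B C => x = y /\ pure y B /\ pure y C
  end.

Lemma pure_term y A B : term A B -> pure y A -> pure y B.
Proof.
  induction 1; simpl; intuition congruence.
Qed.

(** The only generator without an inverse is [ck], and its source contains both connectives. *)
Lemma pure_inverse y A B (f : term A B) : pure y A -> exists g : term B A, g ∘ f === one A.
Proof.
  induction f as [A|A B C g IHg f IHf|x A B A' B' f IHf g IHg|x A B C|x A B C|x A B|A B C D];
    intro HA.
  - exists (one A). apply idl.
  - destruct (IHf HA) as [f' Ef]. destruct (IHg (pure_term f HA)) as [g' Eg].
    exists (f' ∘ g'). now rewrite assoc, (te_assoc g'), Eg, idl.
  - destruct HA as (_ & HA & HB), (IHf HA) as [f' Ef], (IHg HB) as [g' Eg].
    exists (par x f' g'). now rewrite par_comp, Ef, Eg, te_par_id.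
  - exists (b_from x A B C). apply te_b_from_to.
  - exists (b_to x A B C). apply te_b_to_from.
  - exists (csym x B A). apply te_c_inv.
  - destruct HA as [<- [[E _] _]]; discriminate.
Qed.

Lemma letters_length A : 1 <= length (letters A).
Proof. induction A; simpl; rewrite ?length_app; lia. Qed.

Lemma length_bin x A B : length (letters (bin x A B)) <> 1.
Proof.
  simpl. rewrite length_app. pose proof (letters_length A). pose proof (letters_length B). lia.
Qed.

(** Apart from identities and composites, every arrow term starts at a formula with at least two
    letters. The transport along [e] makes the comparison with an identity well typed. *)
Lemma term_from_letter A B (f : term A B) :
  length (letters A) = 1 -> exists e : A = B, f === eq_rect A (term A) (one A) B e.
Proof.
  induction f as [A|A B C g IHg f IHf|x A B A' B' f IHf g IHg|x A B C|x A B C|x A B|A B C D];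
    intro HA;
    try (now apply length_bin in HA).
  - exists eq_refl. reflexivity.
  - destruct (IHf HA) as [<- Ef]. destruct (IHg HA) as [<- Eg].
    exists eq_refl. simpl in *. now rewrite Ef, Eg, idl.
Qed.

Lemma terms_from_letter A B (f g : term A B) : length (letters A) = 1 -> f === g.
Proof.
  intro HA. destruct (term_from_letter f HA) as [e Ef], (term_from_letter g HA) as [e' Eg].
  destruct e. rewrite (UIP_refl _ _ e') in Eg. simpl in *. now rewrite Ef, Eg.
Qed.

Lemma diversified_term A B : term A B -> diversified A -> diversified B.
Proof. intro f. apply Permutation_NoDup, term_letters, f. Qed.

Lemma diversified_bin x A B : diversified (bin x A B) ->
  diversified A /\ diversified B /\ forall p, In p (letters A) -> In p (letters B) -> False.
Proof.
  unfold diversified; simpl. intro H. repeat split.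
  - eapply NoDup_app_remove_r, H.
  - eapply NoDup_app_remove_l, H.
  - intros p Ha Hb. induction (letters A) as [|q l IH]; simpl in *; [tauto|].
    inversion_clear H as [|? ? Hq Hl]. destruct Ha as [->|Ha]; auto using in_or_app.
Qed.

Lemma merge_diag y (s t : shape L) : merge y y s t = merge_same y s t.
Proof. now destruct y. Qed.

Lemma status_at_pure y S A : pure y A -> status_at y S A <> None.
Proof.
  induction A as [p|x A IHA B IHB]; simpl.
  - destruct (S p); discriminate.
  - intros (-> & HA & HB). specialize (IHA HA). specialize (IHB HB).
    destruct (status_at y S A) as [[s f]|], (status_at y S B) as [[t g]|]; try tauto.
    destruct s, t, y; discriminate.
Qed.

(** With [S] at most a singleton, every factor not of shape [shR] contains [q]; in a diversified
    formula at most one factor does. *)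
Lemma status_at_letter_in y (S : L -> bool) q A :
  (forall p, S p = true -> p = q) ->
  match status_at y S A with
  | None | Some (Status (shR _) _) => True
  | Some _ => In q (letters A)
  end.
Proof.
  intro HS. pose proof (status_at_kind y S A) as K. destruct (letters_nonempty A) as [a Ha].
  destruct (status_at y S A) as [[[A'|A'|U V] f]|]; simpl in K; trivial.
  - now rewrite <- (HS a (K a Ha)).
  - destruct K as [(p & Hp & E) _]. now rewrite <- (HS p E).
Qed.

End Pure.

(** * Coherence for a single connective *)

Ltac structural_inverse :=
  rewrite ?par_comp, ?te_b_to_from, ?te_b_from_to, ?te_c_inv, ?idl, ?par_one; reflexivity.

Ltac split_witness :=
  first [ exact I | do 2 eexists; first [reflexivity | symmetry; apply te_par_id] ].

Ltac lifts_iso_with h k :=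
  exists h, k;
  refine (conj _ (conj _ (conj _ (conj _ _))));
  [ split_witness | split_witness | structural_inverse | structural_inverse
  | repeat progress rewrite ?par_one, ?idr, ?idl ].

(* With [S] at most a singleton and no repeated letter, at most one of [A], [B], [C] is not
   [shR]; the remaining cases are pentagons and hexagons. *)
Lemma lifts_iso_b_pure y A B C (S : nat -> bool) q :
  (forall p, S p = true -> p = q) ->
  diversified (bin y A (bin y B C)) ->
  pure y (bin y A (bin y B C)) ->
  lifts_iso (b_to y A B C) (status_at y S (bin y A (bin y B C)))
    (status_at y S (bin y (bin y A B) C)).
Proof.
  intros HS HD (_ & PA & _ & PB & PC).
  apply diversified_bin in HD. destruct HD as (_ & HD & HA).
  apply diversified_bin in HD. destruct HD as (_ & _ & HB). simpl in HA.
  assert (HAB : In q (letters A) -> In q (letters B) -> False) by eauto using in_or_app.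
  assert (HAC : In q (letters A) -> In q (letters C) -> False) by eauto using in_or_app.
  specialize (HB q). clear HA.
  pose proof (@status_at_letter_in _ y S q A HS) as NA.
  pose proof (@status_at_letter_in _ y S q B HS) as NB.
  pose proof (@status_at_letter_in _ y S q C HS) as NC.
  pose proof (@status_at_pure _ y S A PA). pose proof (@status_at_pure _ y S B PB).
  pose proof (@status_at_pure _ y S C PC). simpl.
  destruct (status_at y S A) as [[s f]|], (status_at y S B) as [[t g]|],
    (status_at y S C) as [[r h]|]; try tauto.
  apply lifts_iso_b.
  clear - HAB HAC HB NA NB NC.
  (* The surviving shapes are, in order, lrr, rlr, rrl, rrr, rrs, rsr, srr. *)
  destruct s as [A'|A'|U V], t as [B'|B'|U' V'], r as [C'|C'|U'' V''];
   try (exfalso; tauto); clear; unfold smerge, unit_status;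
   repeat (rewrite merge_diag; cbn -[merge]).
  - lifts_iso_with (one (bin y A' (bin y B' C'))) (one (bin y A' (bin y B' C'))).
    apply te_b_from_to.
  - lifts_iso_with (one (bin y B' (bin y A' C'))) (one (bin y B' (bin y A' C'))).
    reflexivity.
  - lifts_iso_with (one (bin y C' (bin y A' B'))) (one (bin y C' (bin y A' B'))).
    apply hex_rrl.
  - lifts_iso_with (b_to y A' B' C') (b_from y A' B' C').
    reflexivity.
  - lifts_iso_with (par y (one U'') (b_to y A' B' V'')) (par y (one U'') (b_from y A' B' V'')).
    symmetry; apply hex_rrs.
  - lifts_iso_with (par y (one U') (b_to y A' V' C')) (par y (one U') (b_from y A' V' C')).
    symmetry; apply pent_rsr.
  - lifts_iso_with (par y (one U) (b_to y V B' C')) (par y (one U) (b_from y V B' C')).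
    symmetry; apply pent_srr.
Qed.

(** At most one factor contains [q], which leaves lr, rl, rr, rs and sr; the last two are the
    hexagon and its inverted form. *)
Lemma lifts_iso_c_pure y A B (S : nat -> bool) q :
  (forall p, S p = true -> p = q) ->
  diversified (bin y A B) ->
  pure y (bin y A B) ->
  lifts_iso (csym y A B) (status_at y S (bin y A B)) (status_at y S (bin y B A)).
Proof.
  intros HS HD (_ & PA & PB).
  apply diversified_bin in HD. destruct HD as (_ & _ & HAB). specialize (HAB q).
  pose proof (@status_at_letter_in _ y S q A HS) as NA.
  pose proof (@status_at_letter_in _ y S q B HS) as NB.
  pose proof (@status_at_pure _ y S A PA). pose proof (@status_at_pure _ y S B PB).
  simpl.
  destruct (status_at y S A) as [[s f]|], (status_at y S B) as [[t g]|]; try tauto.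
  apply lifts_iso_c.
  clear - HAB NA NB.
  destruct s as [A'|A'|U V], t as [B'|B'|U' V'];
   try (exfalso; tauto); clear; unfold smerge, unit_status;
   repeat (rewrite merge_diag; cbn -[merge]).
  - lifts_iso_with (one (bin y A' B')) (one (bin y A' B')).
    apply te_c_inv.
  - lifts_iso_with (one (bin y B' A')) (one (bin y B' A')).
    reflexivity.
  - lifts_iso_with (csym y A' B') (csym y B' A').
    reflexivity.
  - lifts_iso_with (par y (one U') (csym y A' V')) (par y (one U') (csym y V' A')).
    rewrite te_hexagon. unfold w_rs. rewrite !assoc, b_from_to_mid. reflexivity.
  - lifts_iso_with (par y (one U) (csym y V B')) (par y (one U) (csym y B' V)).
    apply (@iso_r _ _ _ _ (csym y B' (bin y U V)) (csym y (bin y U V) B')); [apply te_c_inv|].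
    rewrite !assoc, te_c_inv, idr, te_hexagon. unfold w_rs.
    rewrite !assoc, b_from_to_mid, par_comp_l, te_c_inv, idl, par_one, idl. reflexivity.
Qed.

(** A letter [q] of the target is split off. The separation [b] of the target is invertible because
    [B] is pure, so it can be cancelled, and both components of the arrow have fewer letters. *)
Theorem pure_coherence y (n : nat) : forall A B (f g : @term nat A B),
  length (letters A) <= n -> pure y A -> diversified A -> f === g.
Proof.
  induction n as [|n IH]; intros A B f g Hn PA DA.
  { pose proof (letters_length A). lia. }
  destruct A as [p|x A1 A2]; [now apply terms_from_letter|].
  destruct PA as [-> PA].
  destruct (letters_nonempty B) as [q Hq].
  simpl in Hn. rewrite length_app in Hn.
  set (A := bin y A1 A2) in *.
  assert (PB : pure y B) by (apply (pure_term f); now split).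
  assert (DB : diversified B) by exact (diversified_term f DA).
  set (S := Nat.eqb q).
  assert (HS : forall p, S p = true -> p = q).
  { intros p Hp. symmetry. now apply Nat.eqb_eq. }
  assert (N : forall C D (h : @term nat C D), pure y C /\ diversified C ->
            lifts h (status_at y S C) (status_at y S D)).
  { apply status_at_lifts.
    - intros C D h [PC DC]. split; [exact (pure_term h PC)|exact (diversified_term h DC)].
    - intros x C D [(_ & PC & PD) DC]. apply diversified_bin in DC. tauto.
    - intros x C D E [PC DC]. assert (x = y) as -> by apply PC.
      now apply lifts_iso_b_pure with q.
    - intros x C D [PC DC]. assert (x = y) as -> by apply PC.
      now apply lifts_iso_c_pure with q.
    - intros C D E F [[<- [[H _] _]] _]. discriminate. }
  assert (PAA : pure y A) by now split.
  pose proof (N _ _ f (conj PAA DA)) as Hf. pose proof (N _ _ g (conj PAA DA)) as Hg.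
  clear N. pose proof (status_at_kind y S B) as KB.
  pose proof (@status_at_pure _ y S B PB) as NB.
  assert (LB : 2 <= length (letters B)).
  { rewrite <- (Permutation_length (term_letters f)). simpl. rewrite length_app.
    pose proof (letters_length A1). pose proof (letters_length A2). lia. }
  destruct (status_at y S B) as [[t b]|]; [clear NB|tauto].
  destruct t as [T|T|U V]; simpl in KB.
  (* [B] has at least two letters, all distinct, so they cannot all equal [q]. *)
  - exfalso. clear - LB DB KB HS. destruct (letters B) as [|p [|r l]] eqn:E; simpl in *; try lia.
    unfold diversified in DB. rewrite E in DB. inversion_clear DB as [|? ? H _]. apply H.
    rewrite (HS p), (HS r) by auto. now left.
  - specialize (KB q Hq). unfold S in KB. rewrite Nat.eqb_refl in KB. discriminate.
  - destruct (status_at y S A) as [[s a]|]; [|contradiction].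
    destruct Hf as (h & Sh & Ef), Hg as (k & Sk & Eg).
    destruct s as [T|T|U' V']; simpl in Sh, Sk; try contradiction.
    destruct Sh as (h1 & h2 & Eh), Sk as (k1 & k2 & Ek). simpl in a, b.
    assert (DU : diversified (bin y U' V')) by exact (diversified_term a DA).
    assert (PU : pure y (bin y U' V')) by exact (pure_term a PAA).
    pose proof (Permutation_length (term_letters a)) as Ln. unfold A in Ln. simpl in Ln.
    rewrite !length_app in Ln.
    pose proof (letters_length U'). pose proof (letters_length V').
    apply diversified_bin in DU. destruct PU as (_ & PU & PV).
    destruct (pure_inverse b PB) as [b' Eb].
    apply (iso_l Eb). rewrite Ef, Eg, Eh, Ek.
    rewrite (IH _ _ h1 k1), (IH _ _ h2 k2); try tauto; try reflexivity; lia.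
Qed.

(** * Structural equations between arbitrary formulae, by substitution and reification *)

Fixpoint subst (L L' : Type) (v : L -> formula L') (A : formula L) : formula L' :=
  match A with
  | letter p => v p
  | bin x B C => bin x (subst v B) (subst v C)
  end.

Fixpoint subst_term (L L' : Type) (v : L -> formula L') (A B : formula L) (f : term A B) :
    term (subst v A) (subst v B) :=
  match f in term A B return term (subst v A) (subst v B) with
  | one A => one (subst v A)
  | comp g f => comp (subst_term v g) (subst_term v f)
  | par x f g => par x (subst_term v f) (subst_term v g)
  | b_to x A B C => b_to x (subst v A) (subst v B) (subst v C)
  | b_from x A B C => b_from x (subst v A) (subst v B) (subst v C)
  | csym x A B => csym x (subst v A) (subst v B)
  | ck A B C D => ck (subst v A) (subst v B) (subst v C) (subst v D)
  end.

Lemma subst_eq (L L' : Type) (v : L -> formula L') (A B : formula L) (f g : term A B) :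
  f === g -> subst_term v f === subst_term v g.
Proof.
  induction 1; simpl; try (constructor; assumption).
  etransitivity; eassumption.
Qed.

(** The formulae substituted for the letters may coincide or repeat letters: coherence is applied to
    the distinct numbered letters, and the equation is carried over. *)
Corollary structural_coherence (L : Type) (v : nat -> formula L) y A B (f g : @term nat A B) :
  pure y A -> diversified A -> subst_term v f === subst_term v g.
Proof. intros PA DA. apply subst_eq. now apply (@pure_coherence y (length (letters A))). Qed.

Ltac index_of a l :=
  match l with
  | a :: _ => constr:(0)
  | _ :: ?l' => let n := index_of a l' in constr:(S n)
  end.
Ltac add_atom a l :=
  match l with
  | context [a :: _] => l
  | _ => constr:(a :: l)
  end.
Ltac atoms_of A l :=
  match A with
  | bin _ ?B ?C => let l' := atoms_of B l in atoms_of C l'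
  | _ => add_atom A l
  end.
Ltac quote_formula l A :=
  match A with
  | bin ?x ?B ?C =>
      let b := quote_formula l B in let c := quote_formula l C in constr:(bin x b c)
  | _ => let n := index_of A l in constr:(@letter nat n)
  end.
Ltac quote_term l f :=
  match f with
  | one ?A => let a := quote_formula l A in constr:(one a)
  | comp ?g ?h => let g' := quote_term l g in let h' := quote_term l h in constr:(comp g' h')
  | par ?x ?g ?h => let g' := quote_term l g in let h' := quote_term l h in constr:(par x g' h')
  | csym ?x ?A ?B =>
      let a := quote_formula l A in let b := quote_formula l B in constr:(csym x a b)
  | b_to ?x ?A ?B ?C =>
      let a := quote_formula l A in let b := quote_formula l B in
      let c := quote_formula l C in constr:(b_to x a b c)
  | b_from ?x ?A ?B ?C =>
      let a := quote_formula l A in let b := quote_formula l B in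
      let c := quote_formula l C in constr:(b_from x a b c)
  end.

(** The atoms of the source suffice, as arrows preserve letters. Each atom is quoted as its position
    in [l], so the default [d] of [nth] is never reached by a quoted letter. *)
Ltac by_structural_coherence :=
  unfold w_ss, w_sl, w_rs;
  lazymatch goal with
  | |- @term_eq ?L ?A _ ?f ?g =>
      let l := atoms_of A (@nil (formula L)) in
      let f' := quote_term l f in
      let g' := quote_term l g in
      lazymatch l with
      | ?d :: _ => lazymatch A with
        | bin ?y _ _ =>
          refine (@structural_coherence L (fun n => nth n l d) y _ _ f' g' _ _);
          [ simpl; tauto
          | unfold diversified; simpl; repeat constructor; simpl; intuition discriminate ]
        end
      end
  end.

Tactic Notation "lifts_iso_by" uconstr(h) "and" uconstr(k) :=
  refine (ex_intro _ h (ex_intro _ k (conj _ (conj _ (conj _ (conj _ _))))));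
  [ first [exact I | do 2 eexists; reflexivity] | first [exact I | do 2 eexists; reflexivity]
  | by_structural_coherence .. ].

Ltac lifts_by h :=
  exists h; split; [do 2 eexists; reflexivity|];
  repeat progress rewrite ?par_one, ?idr, ?idl.

(** * Naturality of separation for both connectives, and coherence *)

Section Coherence.
Variable L : Type.
Implicit Types A B C D U V : formula L.

(** For [x = y] every case is structural; a component of the witness is an associativity if three
    factors contribute to it, and an identity otherwise. For [x <> y] the three kinds must agree,
    and three separated disjuncts give the condition [te_ck_b_disj]. *)
Lemma lifts_iso_b_shape x y (s t r : shape L) :
  lifts_iso (b_to x _ _ _)
    (smerge x (unit_status y s) (smerge x (unit_status y t) (unit_status y r)))
    (smerge x (smerge x (unit_status y s) (unit_status y t)) (unit_status y r)).
Proof.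
  assert (E : x = y \/ x <> y) by (destruct x, y; auto; right; discriminate).
  destruct E as [<-|E].
  - destruct s as [A|A|U V], t as [B|B|U' V'], r as [C|C|U'' V''];
      unfold smerge, unit_status; repeat (rewrite merge_diag; cbn -[merge]);
      first
      [ lifts_iso_by (b_to x A B C) and (b_from x A B C)
      | lifts_iso_by (par x (one _) (one _)) and (par x (one _) (one _))
      | lifts_iso_by (par x (b_to x _ _ _) (one _)) and (par x (b_from x _ _ _) (one _))
      | lifts_iso_by (par x (one _) (b_to x _ _ _)) and (par x (one _) (b_from x _ _ _))
      | lifts_iso_by (par x (b_to x _ _ _) (b_to x _ _ _)) and (par x (b_from x _ _ _) (b_from x _ _ _)) ].
  - destruct x, y; try congruence; clear E;
    destruct s as [A|A|U V], t as [B|B|U' V'], r as [C|C|U'' V'']; simpl; trivial;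
      try (lifts_iso_by (b_to Conj A B C) and (b_from Conj A B C));
      try (lifts_iso_by (b_to Disj A B C) and (b_from Disj A B C)).
    exists (par Conj (b_to Disj U U' U'') (b_to Disj V V' V'')),
      (par Conj (b_from Disj U U' U'') (b_from Disj V V' V'')).
    rewrite !par_comp, !te_b_to_from, !te_b_from_to, !par_one, !idr.
    repeat split; try reflexivity; try (do 2 eexists; reflexivity).
    rewrite te_ck_b_disj, !assoc. reflexivity.
Qed.

Lemma lifts_iso_c_shape x y (s t : shape L) :
  lifts_iso (csym x _ _)
    (smerge x (unit_status y s) (unit_status y t))
    (smerge x (unit_status y t) (unit_status y s)).
Proof.
  assert (E : x = y \/ x <> y) by (destruct x, y; auto; right; discriminate).
  destruct E as [<-|E].
  - destruct s as [A|A|U V], t as [B|B|U' V'];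
      unfold smerge, unit_status; repeat (rewrite merge_diag; cbn -[merge]);
      first
      [ lifts_iso_by (csym x A B) and (csym x B A)
      | lifts_iso_by (par x (one _) (one _)) and (par x (one _) (one _))
      | lifts_iso_by (par x (csym x _ _) (one _)) and (par x (csym x _ _) (one _))
      | lifts_iso_by (par x (one _) (csym x _ _)) and (par x (one _) (csym x _ _))
      | lifts_iso_by (par x (csym x _ _) (csym x _ _)) and (par x (csym x _ _) (csym x _ _)) ].
  - destruct x, y; try congruence; clear E;
    destruct s as [A|A|U V], t as [B|B|U' V']; simpl; trivial;
      try (lifts_iso_by (csym Conj A B) and (csym Conj B A));
      try (lifts_iso_by (csym Disj A B) and (csym Disj B A)).
    exists (par Conj (csym Disj U U') (csym Disj V V')),
      (par Conj (csym Disj U' U) (csym Disj V' V)).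
    rewrite !par_comp, !te_c_inv, !par_one, !idr.
    repeat split; try reflexivity; try (do 2 eexists; reflexivity).
    apply te_ck_c_disj.
Qed.

(** The condition [te_ck_b_conj] with its associativities inverted. *)
Lemma ck_b_to A B C A' B' C' :
  b_to Conj (bin Disj A A') (bin Disj B B') (bin Disj C C')
    ∘ (par Conj (one _) (ck B C B' C') ∘ ck A (bin Conj B C) A' (bin Conj B' C'))
  === par Conj (ck A B A' B') (one _) ∘ ck (bin Conj A B) C (bin Conj A' B') C'
      ∘ par Disj (b_to Conj A B C) (b_to Conj A' B' C').
Proof.
  pose proof (te_ck_b_conj A A' B B' C C') as H.
  apply (iso_l (te_b_to_from Conj (bin Disj A A') (bin Disj B B') (bin Disj C C'))).
  rewrite b_from_to_mid, !te_assoc, H, !assoc.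
  now rewrite par_comp, !te_b_from_to, par_one, idr.
Qed.

(** A middle exchange consists of associativities and a symmetry, and [ck] passes each of them by
    its own condition. The next two lemmas rest on the same principle. *)
Lemma ck_w_rs A U V A' U' V' :
  w_rs Conj (bin Disj A A') (bin Disj U U') (bin Disj V V')
    ∘ (par Conj (one _) (ck U V U' V') ∘ ck A (bin Conj U V) A' (bin Conj U' V'))
  === par Conj (one _) (ck A V A' V') ∘ ck U (bin Conj A V) U' (bin Conj A' V')
      ∘ par Disj (w_rs Conj A U V) (w_rs Conj A' U' V').
Proof.
  unfold w_rs. rewrite !assoc, ck_b_to, !assoc.
  rewrite par_comp_l, te_ck_c_conj, idl, par_comp_one, !assoc.
  rewrite <- (par_one Disj V V'), (te_assoc (par Conj (par Disj _ _) _)), te_ck_nat.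
  rewrite par_one, !te_assoc, te_ck_b_conj, !assoc, !par_comp. reflexivity.
Qed.

Lemma ck_w_sl U V B U' V' B' :
  w_sl Conj (bin Disj U U') (bin Disj V V') (bin Disj B B')
    ∘ (par Conj (ck U V U' V') (one _) ∘ ck (bin Conj U V) B (bin Conj U' V') B')
  === par Conj (ck U B U' B') (one _) ∘ ck (bin Conj U B) V (bin Conj U' B') V'
      ∘ par Disj (w_sl Conj U V B) (w_sl Conj U' V' B').
Proof.
  unfold w_sl. rewrite !assoc, (te_assoc (b_from _ _ _ _)), te_ck_b_conj, !assoc.
  rewrite par_comp_l, te_ck_c_conj, idl, par_one_comp, !assoc.
  rewrite <- (par_one Disj U U'), (te_assoc (par Conj _ (par Disj _ _))), te_ck_nat.
  rewrite par_one, (te_assoc (par Conj _ (ck _ _ _ _))), (te_assoc (b_to _ _ _ _)).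
  rewrite (te_assoc (par Conj _ (ck _ _ _ _))).
  rewrite (te_assoc (b_to _ _ _ _)), ck_b_to, !assoc, !par_comp. reflexivity.
Qed.

Lemma ck_w_ss A B C D A' B' C' D' :
  w_ss Conj (bin Disj A A') (bin Disj B B') (bin Disj C C') (bin Disj D D')
    ∘ (par Conj (ck A B A' B') (ck C D C' D')
       ∘ ck (bin Conj A B) (bin Conj C D) (bin Conj A' B') (bin Conj C' D'))
  === par Conj (ck A C A' C') (ck B D B' D')
      ∘ ck (bin Conj A C) (bin Conj B D) (bin Conj A' C') (bin Conj B' D')
      ∘ par Disj (w_ss Conj A B C D) (w_ss Conj A' B' C' D').
Proof.
  unfold w_ss.
  (* The two parallel [ck] are made successive: the first then meets [te_ck_b_conj], and the second
     passes [b_from] by naturality. *)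
  assert (E : par Conj (ck A B A' B') (ck C D C' D')
    === par Conj (par Conj (one _) (one _)) (ck C D C' D') ∘ par Conj (ck A B A' B') (one _))
    by now rewrite par_comp, par_one, idl, idr.
  rewrite E, !assoc, (te_assoc (b_from _ _ _ _)), <- b_from_nat, !assoc.
  rewrite (te_assoc (b_from _ _ _ _)), te_ck_b_conj, !assoc.
  rewrite !par_comp_l, !idl, !assoc, ck_w_rs, !par_one_comp, !assoc.
  rewrite <- (par_one Disj A A'), (te_assoc (par Conj _ (par Disj _ _))), te_ck_nat, !assoc.
  rewrite (te_assoc (b_to _ _ _ _)), <- te_b_nat, !assoc.
  rewrite !par_one, (te_assoc (par Conj _ (ck _ _ _ _)) (ck _ _ _ _)).
  rewrite (te_assoc (b_to _ _ _ _)), ck_b_to, !assoc.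
  rewrite (te_assoc (par Conj (one _) _)), !par_comp, idl, idr. reflexivity.
Qed.

(** If the target is separable then, for [y = Conj], [s] and [r] have the same kind, and so have [t]
    and [u]; for [y = Disj] all four are l or all four are r. The bullets treat, by the two common
    kinds, lr, ls, rl, rs, sl, sr, ss. *)
Lemma lifts_ck_shape y (s t r u : shape L) :
  lifts (ck _ _ _ _)
    (smerge Disj (smerge Conj (unit_status y s) (unit_status y t))
                 (smerge Conj (unit_status y r) (unit_status y u)))
    (smerge Conj (smerge Disj (unit_status y s) (unit_status y r))
                 (smerge Disj (unit_status y t) (unit_status y u))).
Proof.
  destruct y, s as [A|A|A A'], r as [C|C|C C']; simpl; trivial;
  destruct t as [B|B|B B'], u as [D|D|D D']; simpl; trivial;
  match goal with
  | |- exists h : term (bin Disj (bin Conj ?A ?B) (bin Conj ?C ?D)) _, True /\ _ =>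
      exists (ck A B C D); split; [exact I|];
      repeat progress rewrite ?par_one, ?idr, ?idl; reflexivity
  | |- _ => idtac
  end.
  - lifts_by (par Conj (one (bin Disj A C)) (one (bin Disj B D))).
    reflexivity.
  - lifts_by (par Conj (ck A B C D) (one (bin Disj B' D'))).
    rewrite !assoc. rewrite ck_b_to, assoc. reflexivity.
  - lifts_by (par Conj (one (bin Disj B D)) (one (bin Disj A C))).
    apply te_ck_c_conj.
  - lifts_by (par Conj (one (bin Disj B D)) (ck A B' C D')).
    rewrite !assoc. rewrite ck_w_rs, assoc. reflexivity.
  - lifts_by (par Conj (ck A B C D) (one (bin Disj A' C'))).
    rewrite !assoc. rewrite ck_w_sl, assoc. reflexivity.
  - lifts_by (par Conj (one (bin Disj A C)) (ck A' B C' D)).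
    rewrite te_ck_b_conj, assoc. reflexivity.
  - lifts_by (par Conj (ck A B C D) (ck A' B' C' D')).
    rewrite !assoc. rewrite ck_w_ss, assoc. reflexivity.
Qed.

Lemma status_at_natural y S A B (f : @term L A B) :
  lifts f (status_at y S A) (status_at y S B).
Proof.
  apply (@status_at_lifts _ y S (fun _ => True)); trivial; clear.
  - tauto.
  - intros x A B C _. simpl.
    destruct (status_at y S A) as [[s f]|], (status_at y S B) as [[t g]|],
      (status_at y S C) as [[r h]|];
      try (apply lifts_iso_b, lifts_iso_b_shape);
      simpl; try destruct (merge _ _ _ _) as [[]|]; exact I.
  - intros x A B _. simpl.
    destruct (status_at y S A) as [[s f]|], (status_at y S B) as [[t g]|];
      try (apply lifts_iso_c, lifts_iso_c_shape); exact I.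
  - intros A B C D _. simpl.
    destruct (status_at y S A) as [[s f]|], (status_at y S B) as [[t g]|],
      (status_at y S C) as [[r h]|], (status_at y S D) as [[u k]|];
      try (apply lifts_ck, lifts_ck_shape);
      cbn -[merge]; repeat (destruct (merge _ _ _ _) as [[]|]; cbn -[merge]); exact I.
Qed.

Theorem diversified_coherence (n : nat) : forall A B (f g : @term L A B),
  length (letters B) <= n -> diversified B -> f === g.
Proof.
  induction n as [|n IH]; intros A B f g Hn DB.
  { pose proof (letters_length B). lia. }
  destruct B as [p|y B1 B2].
  { apply terms_from_letter. now rewrite (Permutation_length (term_letters f)). }
  (* Membership is decided classically, the type of letters being arbitrary. *)
  pose (S p := if excluded_middle_informative (In p (letters B1)) then true else false).
  pose proof (status_at_natural y S f) as Hf. pose proof (status_at_natural y S g) as Hg.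
  destruct (diversified_bin DB) as (D1 & D2 & D12).
  destruct (@status_at_left _ y S B1) as (b1 & E1 & Eb1).
  { intros q Hq. unfold S. now destruct (excluded_middle_informative _). }
  destruct (@status_at_right _ y S B2) as (b2 & E2 & Eb2).
  { intros q Hq. unfold S. destruct (excluded_middle_informative _); trivial.
    exfalso; eauto. }
  simpl in Hf, Hg. rewrite E1, E2 in Hf, Hg. cbn -[merge] in Hf, Hg.
  rewrite merge_diag in Hf, Hg. cbn -[merge] in Hf, Hg.
  destruct (status_at y S A) as [[s a]|]; [|contradiction].
  destruct Hf as (h & Sh & Ef), Hg as (k & Sk & Eg).
  destruct s as [T|T|U V]; simpl in Sh, Sk; try contradiction.
  destruct Sh as (h1 & h2 & Eh), Sk as (k1 & k2 & Ek).
  (* The separation of the target is an identity, so [f] and [g] are products of smaller arrows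
     after the same [a]. *)
  rewrite Eb1, Eb2, par_one, !idl in Ef, Eg.
  rewrite Ef, Eg, Eh, Ek.
  simpl in Hn. rewrite length_app in Hn.
  pose proof (letters_length B1). pose proof (letters_length B2).
  rewrite (IH _ _ h1 k1), (IH _ _ h2 k2); try assumption; try reflexivity; lia.
Qed.
End Coherence.

(** * From arrow terms to their equivalence classes *)

Theorem mainTheorem5 :
  forall (L : Type) (A B : formula L),
    diversified A -> diversified B ->
    forall f g : SCk_arrow A B, f = g.
Proof.
  intros L A B _ DB [X [f ->]] [Y [g ->]].
  apply subset_eq_compat.
  (* Classes are predicates, equal by extensionality once their representatives are related. *)
  apply functional_extensionality; intro h. apply propositional_extensionality.
  assert (E : f === g) by now apply (@diversified_coherence L (length (letters B))).
  now rewrite E.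
Qed.
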